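(* Let $(X,d,T)$ be a conformal system with derivative $a$, let $u=\log a$, and fix a dense sequence $(x_i)_{i\in\mathbb{N}}$ in $X$. Suppose $x\in\mathcal{A}(0,\infty)\cap\mathcal{B}\cap\mathcal{C}$. Then for any oracle $A\subset\mathbb{N}$, $$\dim^A(x)=\dim^A_{\mathrm{BS}}(x,T,u),\qquad \mathrm{Dim}^A(x)=\mathrm{Dim}^A_{\mathrm{BS}}(x,T,u).$$
   Context: $\log$ is base $2$. Conformal system: $X$ is a complete separable metric space with metric $d$, $T\colon X\to X$ is uniformly continuous, the limit $a(x)=\lim_{y\to x}\frac{d(Tx,Ty)}{d(x,y)}$ exists in $(0,\infty)$ for every $x\in X$, and the function $\zeta(x,y)=\log d(Tx,Ty)-\log d(x,y)$ for $x\ne y$, $\zeta(x,x)=\log a(x)$, is uniformly continuous on $\{(x,y): d(x,y)<r_0\}$ for some $r_0>0$. Put $u=\log a$. $S_nu=\sum_{k=0}^{n-1}u\circ T^k$; $\underline{u}(x)=\liminf_n\frac1nS_nu(x)$, $\overline{u}(x)=\limsup_n\frac1nS_nu(x)$. $\mathcal{A}(0,\infty)=\{x:0<\underline{u}(x)\le\overline{u}(x)<\infty\}$. $\mathcal{B}$ is the set of $x$ with $\inf_{n\in\mathbb{N},\,0\le k\le n}\bigl(S_{n-k}u(T^kx)+n\varepsilon\bigr)>-\infty$ for every $\varepsilon>0$. $\mathcal{C}$ is the set of $x$ with $\lim_{n\to\infty}u(T^nx)/n=0$. Complexity: fix a universal prefix-free oracle machine $U$; $K^A(\sigma)=\min\{|\tau|:U^A(\tau)=\sigma\}$;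 natural numbers are identified with strings through a fixed computable coding. Effective dimensions: $K^A_\delta(x)=\min\{K^A(i):d(x_i,x)<\delta\}$, $\dim^A(x)=\liminf_{\delta\to0}\frac{K^A_\delta(x)}{-\log\delta}$, $\mathrm{Dim}^A(x)=\limsup_{\delta\to0}\frac{K^A_\delta(x)}{-\log\delta}$. Pointwise BS dimensions: with $B_n(x,T,\varepsilon)=\{y: d(T^ix,T^iy)<\varepsilon\text{ for }0\le i<n\}$, $\dim^A_{\mathrm{BS}}(x,T,u)=\lim_{\varepsilon\to0}\liminf_{n\to\infty}\min_{x_i\in B_n(x,T,\varepsilon)}\frac{K^A(i)}{S_nu(x_i)}$, and $\mathrm{Dim}^A_{\mathrm{BS}}(x,T,u)$ is the same with $\limsup_{n\to\infty}$ (for $\varepsilon$ small and $n$ large the denominators are positive). *)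

(* Defs.v *)
From HB Require Import structures.
From mathcomp Require Import all_boot all_order all_algebra.
From mathcomp Require Import all_classical all_reals all_analysis.
Set Implicit Arguments.
Unset Strict Implicit.
Unset Printing Implicit Defensive.
Import Order.TTheory GRing.Theory Num.Theory.
Import numFieldNormedType.Exports.
Local Open Scope classical_set_scope.
Local Open Scope ring_scope.

(** * Oracle computation: Kleene's partial recursive functions relative to an
    oracle.  A program does not depend on the oracle. *)

Inductive program :=
| Pzero
| Psucc
| Pproj of nat
| Poracle
| Pcomp of program & seq program
| Prec of program & program
| Pmu of program.

(** [computes A p v y]: with oracle [A], program [p] halts on input [v] with
    output [y].  Missing arguments make a program diverge; extra arguments are
    ignored. *)
Inductive computes (A : set nat) : program -> seq nat -> nat -> Prop :=
| computes_zero v : computes A Pzero v 0%N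
| computes_succ n v : computes A Psucc (n :: v) n.+1
| computes_proj i v : (i < size v)%N -> computes A (Pproj i) v (nth 0%N v i)
| computes_oracle_in n v : A n -> computes A Poracle (n :: v) 1%N
| computes_oracle_out n v : ~ A n -> computes A Poracle (n :: v) 0%N
| computes_comp p qs v ws y :
    size ws = size qs ->
    (forall i, (i < size qs)%N -> computes A (nth Pzero qs i) v (nth 0%N ws i)) ->
    computes A p ws y -> computes A (Pcomp p qs) v y
| computes_rec0 p q v y : computes A p v y -> computes A (Prec p q) (0%N :: v) y
| computes_recS p q n v z y :
    computes A (Prec p q) (n :: v) z -> computes A q [:: n, z & v] y ->
    computes A (Prec p q) (n.+1 :: v) y
| computes_mu p v n (w : nat -> nat) :
    (forall m, (m < n)%N -> computes A p (m :: v) (w m).+1) ->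
    computes A p (n :: v) 0%N -> computes A (Pmu p) v n.

(** Strings are presented to programs through bijective base-2 numeration
    (least significant digit first, [false] and [true] being the digits 1
    and 2). *)
Fixpoint str_num (s : seq bool) : nat :=
  if s is b :: s' then ((str_num s').*2 + b).+1 else 0%N.

Lemma str_num_bij : bijective str_num.
Proof.
have inj : injective str_num.
  elim=> [|b s IHs] [|c t] //= [] E.
  have Eb : b = c by move: (congr1 odd E); rewrite !oddD !odd_double !oddb.
  by rewrite Eb in E *; move/addIn/double_inj/IHs: E => ->.
have surj n : exists s, str_num s = n.
  elim/ltn_ind: n => -[_|n IHn]; first by exists [::].
  have hn : (n./2 < n.+1)%N by rewrite ltnS -{2}(odd_double_half n) -addnn addnCA leq_addr.
  have [s Es] := IHn _ hn.
  by exists (odd n :: s); rewrite /= Es addnC odd_double_half.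
by exists (fun n => sval (cid (surj n))) => [s|n]; [apply: inj|]; case: cid.
Qed.

(** [run M A tau sigma]: $M^A(\tau)=\sigma$. *)
Definition run (M : program) (A : set nat) (tau sigma : seq bool) : Prop :=
  computes A M [:: str_num tau] (str_num sigma).

Definition halts (M : program) (A : set nat) (tau : seq bool) : Prop :=
  exists sigma, run M A tau sigma.

Definition prefix_free (M : program) : Prop :=
  forall A tau tau', halts M A tau -> halts M A tau' -> prefix tau tau' ->
    tau = tau'.

(** $U^A(\rho\tau)\simeq M^A(\tau)$, with $\rho$ depending only on [M]. *)
Definition universal_prefix_free (U : program) : Prop :=
  prefix_free U /\
  forall M, prefix_free M -> exists rho, forall A tau sigma,
    run U A (rho ++ tau) sigma <-> run M A tau sigma.

(** A program with the same output for every oracle computes an (unrelativized)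
    computable function. *)
Definition computable_coding (code : nat -> seq bool) : Prop :=
  injective code /\
  exists p, forall A n, computes A p [:: n] (str_num (code n)).

#[short(type="completeMetricType")]
HB.structure Definition CompleteMetric (R : numDomainType) :=
  { X of CompletePseudoMetric R X & Metric R X }.

Section Complexity.
Context {R : realType}.
Variables (U : program) (code : nat -> seq bool).
Local Open Scope ereal_scope.

(** The infimum is a minimum whenever [sigma] has a description. *)
Definition complexity (A : set nat) (sigma : seq bool) : \bar R :=
  ereal_inf [set (size tau)%:R%:E | tau in [set tau | run U A tau sigma]].

Definition complexity_nat (A : set nat) (i : nat) : \bar R :=
  complexity A (code i).

End Complexity.

Section Conformal.
Context {R : realType}.

Definition log2 (t : R) : R := ln t / ln 2.

Definition distortion (X : metricType R) (T : X -> X) (a : X -> R) (x y : X)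
    : R :=
  if x == y then log2 (a x)
  else log2 (mdist (T x) (T y)) - log2 (mdist x y).

(** The requirement [T x <> T y] makes [log2 (mdist (T x) (T y))] meaningful:
    the distortion has to be real valued where it is uniformly continuous. *)
Record conformal_system (X : completeMetricType R) (T : X -> X) (a : X -> R)
    : Prop := ConformalSystem {
  conformal_unif_continuous : unif_continuous T ;
  conformal_derivative_gt0 : forall x, 0 < a x ;
  conformal_derivative : forall x,
    mdist (T x) (T y) / mdist x y @[y --> x^'] --> a x ;
  conformal_distortion : exists2 r0 : R, 0 < r0 &
    (forall x y, x != y -> mdist x y < r0 -> T x != T y) /\
    (forall e : R, 0 < e -> exists2 h : R, 0 < h & forall x y x' y',
       mdist x y < r0 -> mdist x' y' < r0 ->
       mdist x x' < h -> mdist y y' < h ->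
       `|distortion T a x y - distortion T a x' y'| < e)
}.

Variable X : metricType R.
Variables (T : X -> X) (u : X -> R).

Definition birkhoff_sum (n : nat) (x : X) : R := \sum_(k < n) u (iter k T x).

Definition lower_average (x : X) : \bar R :=
  limn_einf (fun n => (birkhoff_sum n x / n%:R)%:E).

Definition upper_average (x : X) : \bar R :=
  limn_esup (fun n => (birkhoff_sum n x / n%:R)%:E).

Definition calA (l r : \bar R) : set X :=
  [set x | [&& l < lower_average x, lower_average x <= upper_average x
            & upper_average x < r]%E].

Definition calB : set X :=
  [set x | forall eps : R, 0 < eps ->
    (-oo < ereal_inf [set z | exists n k : nat, (k <= n)%N /\
      z = (birkhoff_sum (n - k) (iter k T x) + n%:R * eps)%:E])%E].

Definition calC : set X :=
  [set x | u (iter n T x) / n%:R @[n --> \oo] --> 0].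

Definition bowen_ball (n : nat) (x : X) (eps : R) : set X :=
  [set y | forall i, (i < n)%N -> mdist (iter i T x) (iter i T y) < eps].

Variables (U : program) (code : nat -> seq bool) (xs : nat -> X).
Variable (A : set nat).
Local Open Scope ereal_scope.

Local Notation K := (complexity_nat U code A).

Definition point_complexity (delta : R) (x : X) : \bar R :=
  ereal_inf [set K i | i in [set i | (mdist (xs i) x < delta)%R]].

Definition eff_dim (x : X) : \bar R :=
  limf_einf (fun delta => point_complexity delta x / (- log2 delta)%:E)
    (0%R : R)^'+.

Definition eff_Dim (x : X) : \bar R :=
  limf_esup (fun delta => point_complexity delta x / (- log2 delta)%:E)
    (0%R : R)^'+.

Definition bowen_ratio (x : X) (eps : R) (n : nat) : \bar R :=
  ereal_inf [set K i / (birkhoff_sum n (xs i))%:E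
            | i in [set i | bowen_ball n x eps (xs i)]].

Definition BS_dim (x : X) : \bar R :=
  lim (limn_einf (bowen_ratio x eps) @[eps --> (0%R : R)^'+]).

Definition BS_Dim (x : X) : \bar R :=
  lim (limn_esup (bowen_ratio x eps) @[eps --> (0%R : R)^'+]).

(** The two limits always exist, since Bowen balls grow with the radius. *)
Lemma bowen_ratio_le (x : X) (e e' : R) n : (e <= e')%R ->
  bowen_ratio x e' n <= bowen_ratio x e n.
Proof.
move=> ee'; apply: ereal_inf_le_tmp => _ [i /= xi <-].
by exists i => //= j jn; exact: lt_le_trans (xi j jn) ee'.
Qed.

Lemma limf_esup_le (f g : nat -> \bar R) : (forall n, f n <= g n) ->
  limn_esup f <= limn_esup g.
Proof.
move=> fg; rewrite /limn_esup !limf_esupE; apply: le_ereal_inf_tmp => _ [V FV <-].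
apply: (@le_trans _ _ (ereal_sup (f @` V))).
  by apply: ereal_inf_lbound; exists V.
apply: ge_ereal_sup => _ [n Vn <-]; apply: le_trans (fg n) _.
by apply: ereal_sup_ubound; exists n.
Qed.

Lemma is_cvg_BS_Dim (x : X) :
  cvg (limn_esup (bowen_ratio x eps) @[eps --> (0%R : R)^'+]).
Proof.
apply: nonincreasing_at_right_is_cvge; near=> b => e e' _ _ ee'.
by apply: limf_esup_le => n; exact: bowen_ratio_le.
Unshelve. all: by end_near. Qed.

Lemma is_cvg_BS_dim (x : X) :
  cvg (limn_einf (bowen_ratio x eps) @[eps --> (0%R : R)^'+]).
Proof.
apply: nonincreasing_at_right_is_cvge; near=> b => e e' _ _ ee'.
rewrite /limn_einf leeN2; apply: limf_esup_le => n.
by rewrite leeN2; exact: bowen_ratio_le.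
Unshelve. all: by end_near. Qed.

End Conformal.

(* Main.v *)
Require Import Defs.
From mathcomp Require Import all_boot all_order all_algebra.
From mathcomp Require Import all_classical all_reals all_analysis.
From mathcomp Require Import ring lra.
Import Order.TTheory GRing.Theory Num.Theory.
Import numFieldNormedType.Exports.
Local Open Scope classical_set_scope.
Local Open Scope ring_scope.

(** Both dimensions compare the same complexities [K i]: one minimizes them over
    the [xs i] in a metric ball around [x], the other over those in a Bowen ball.
    So it suffices that the two kinds of balls agree up to an error that is
    negligible on the exponential scale.  Writing [s n] for the Birkhoff sum of
    [u] along the first [n] points of the orbit of [x], for small [eps] and
    large [n]
      ball of radius 2^(-(1 + theta) s n)  is contained in  bowen_ball n eps,
      which is contained in  ball of radius 2^(-(1 - theta) s n)
    ([bowen_ball_sandwich]).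

    This is a telescoping argument.  By uniform continuity of the distortion,
    two points whose orbits stay [eps]-close for [k] steps have their
    log-distance increased by [s k] up to [k * eta] ([log2_mdist_iter]).
    - A point of the Bowen ball is still [eps]-close after [n - 1] steps; going
      back to time 0 bounds its distance to [x].  This loses the last term
      [u (T^(n-1) x)], which is o(n) by membership in [calC].
    - Conversely, a point of the small ball could leave the [eps]-neighbourhood
      of the orbit of [x] at an intermediate time [k] only if [s k] were much
      larger than [s n], which is what membership in [calB] excludes.
    Membership in [calA] makes [s n] grow linearly, so that every error o(n) is
    also o(s n).

    The sandwich bounds the ratio defining the effective dimension at radius [d]
    by the Bowen ratio at time [n], and conversely, up to a factor [C] close to
    1, whenever - log2 d and [s n] are close to each other.  Every large [n] is
    matched with such a small [d]; and every small [d] with such a large [n],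
    because [s (n + 1)] is at most (1 + theta) times [s n].  Matching in both
    directions is what gives the two inequalities, for the lower and for the
    upper limits ([limits_comparable]).  Finally [eps] tends to 0 and then [C]
    tends to 1. *)
Set Implicit Arguments.
Unset Strict Implicit.
Unset Printing Implicit Defensive.

(** * Extended reals and limits along filters *)
Lemma lee_div_posr {R : realType} (z y : \bar R) (r : R) : 0 < r ->
  (z / r%:E <= y)%E = (z <= y * r%:E)%E.
Proof. by move=> r0; rewrite inver gt_eqF// lee_pdivrMr. Qed.

Lemma le_mul_gt1_ereal {R : realType} (z y : \bar R) :
  (forall C : R, 1 < C -> (z <= C%:E * y)%E) -> (z <= y)%E.
Proof.
have lt12 : 1 < 2 :> R by lra.
case: y => [r| |] H; last 2 first.
- by rewrite leey.
- by have := H 2 lt12; rewrite gt0_muleNy// lte_fin.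
case: z H => [s| |] H; last 2 first.
- by have := H 2 lt12; rewrite -EFinM leye_eq.
- by rewrite leNye.
rewrite lee_fin; apply/ler_addgt0Pr => e e0.
have [r0|r0] := leP r 0.
  have := H 2 lt12; rewrite -EFinM lee_fin => H2; lra.
have := H (1 + e / r); rewrite -EFinM lee_fin mulrDl mul1r divfK ?gt_eqF//.
by apply; rewrite ltrDl divr_gt0.
Qed.

(** A value of [f] on every set of [F] lies below [C * g j] for almost all [j]:
    so an infimum of [f] over such a set is eventually a lower bound of [C * g].
    No map between the index sets is required, which allows matching radii with
    times in either direction. *)
Lemma limf_einf_le_pmul {R : realType} {I J : choiceType} {X : filteredType I}
    {Y : filteredType J} (F : set_system X) (G : set_system Y)
    (f : X -> \bar R) (g : Y -> \bar R) (C : R) : 0 < C ->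
  (forall V, F V ->
    \forall j \near G, exists2 i, V i & (f i <= C%:E * g j)%E) ->
  (limf_einf f F <= C%:E * limf_einf g G)%E.
Proof.
move=> C0 H; rewrite !limf_einfE; apply: ge_ereal_sup => _ [V FV <-].
rewrite -lee_pdivrMl//.
apply: (@le_trans _ _ (ereal_inf
    (g @` [set j | exists2 i, V i & (f i <= C%:E * g j)%E]))).
  apply: le_ereal_inf_tmp => _ [j [i Vi fg] <-]; rewrite lee_pdivrMl//.
  by apply: le_trans fg; apply: ereal_inf_lbound; exists i.
apply: ereal_sup_ubound.
by exists [set j | exists2 i, V i & (f i <= C%:E * g j)%E] => //; exact: H.
Qed.

Lemma limf_esup_le_pmul {R : realType} {I J : choiceType} {X : filteredType I}
    {Y : filteredType J} (F : set_system X) (G : set_system Y)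
    (f : X -> \bar R) (g : Y -> \bar R) (C : R) : 0 < C ->
  (forall V, F V ->
    \forall j \near G, exists2 i, V i & (g j <= C%:E * f i)%E) ->
  (limf_esup g G <= C%:E * limf_esup f F)%E.
Proof.
move=> C0 H; rewrite -lee_pdivrMl// !limf_esupE.
apply: le_ereal_inf_tmp => _ [V FV <-]; rewrite lee_pdivrMl//.
apply: (@le_trans _ _ (ereal_sup
    (g @` [set j | exists2 i, V i & (g j <= C%:E * f i)%E]))).
  apply: ereal_inf_lbound.
  by exists [set j | exists2 i, V i & (g j <= C%:E * f i)%E] => //; exact: H.
apply: ge_ereal_sup => _ [j [i Vi gf] <-]; apply: le_trans gf _.
rewrite lee_pmul2l ?lte_fin//.
by apply: ereal_sup_ubound; exists i.
Qed.

(** * Radii on the logarithmic scale *)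
Lemma ln2_gt0 {R : realType} : 0 < ln 2 :> R.
Proof. by rewrite ln_gt0// ltr1n. Qed.

Lemma ltr_log2 {R : realType} (r s : R) : 0 < r -> 0 < s ->
  (log2 r < log2 s) = (r < s).
Proof.
by move=> r0 s0; rewrite /log2 ltr_pM2r ?invr_gt0 ?ln2_gt0// ltr_ln// posrE.
Qed.

Lemma log2_powR {R : realType} (t : R) : log2 (2 `^ t) = t.
Proof. by rewrite /log2 ln_powR mulfK// gt_eqF// ln2_gt0. Qed.

Lemma at_right0_log2P {R : realType} (V : set R) :
  (\forall d \near 0^'+, V d) <->
  exists M : R, forall d, 0 < d -> M < - log2 d -> V d.
Proof.
split=> [|[M HM]].
  rewrite near_withinE near_simpl => /nbhs_ballP[e /= e0 He].
  exists (- log2 e) => d d0; rewrite ltrN2 ltr_log2// => de.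
  by apply: He => //=; rewrite /ball/= sub0r normrN gtr0_norm.
have p0 : 0 < 2 `^ (- M) :> R by rewrite powR_gt0.
near=> d.
have d0 : 0 < d by near: d; exact: nbhs_right_gt.
have dM : d < 2 `^ (- M) by near: d; exact: nbhs_right_lt.
apply: HM => //.
by rewrite ltrNr -[ltRHS]log2_powR ltr_log2.
Unshelve. all: by end_near. Qed.

(** Matches every large time with a radius. *)
Lemma eventually_radius {R : realType} (s : nat -> R) (c : R) (V : set R) :
  s n @[n --> \oo] --> +oo -> 0 < c -> (\forall d \near 0^'+, V d) ->
  \forall n \near \oo, exists2 d, V d & 0 < d /\ - log2 d = c * s n.
Proof.
move=> /cvgryPgt soo c0 /at_right0_log2P[M HM].
near=> n; exists (2 `^ (- (c * s n))); last first.
  by rewrite powR_gt0// log2_powR opprK.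
apply: HM; first by rewrite powR_gt0.
rewrite log2_powR opprK mulrC -ltr_pdivrMr//.
by near: n; exact: soo.
Unshelve. all: by end_near. Qed.

(** Matches every small radius with a time: [n.+1] is the first time, after those
    excluded by [V], at which [c * s] exceeds - log2 d.  It exists since [s] is
    unbounded. *)
Lemma eventually_crossing {R : realType} (s : nat -> R) (c : R) (V : set nat) :
  s n @[n --> \oo] --> +oo -> 0 < c -> (\forall n \near \oo, V n) ->
  \forall d \near 0^'+, exists n,
    [/\ V n, V n.+1 & c * s n <= - log2 d < c * s n.+1].
Proof.
move=> /cvgryPgt soo c0 [N _ HN]; apply/at_right0_log2P.
exists (c * s N) => d d0 Nd.
have ex : exists m, - log2 d < c * s (N + m)%N.
  have [M _ HM] := soo (- log2 d / c).
  (* The index is taken as [N + M] so that it exceeds both bounds. *)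
  exists M; rewrite [ltRHS]mulrC -ltr_pdivrMr//; apply: HM.
  by rewrite /= leq_addl.
case: (ex_minnP ex) => [[|m]]; first by rewrite addn0 ltNge (ltW Nd).
rewrite addnS => dm min; exists (N + m)%N; split.
- by apply: HN; rewrite /= leq_addr.
- by apply: HN; rewrite /= -addnS leq_addr.
- rewrite dm andbT leNgt; apply/negP => /min; by rewrite ltnn.
Qed.

(** * Expansion along orbits that stay close *)
Lemma birkhoff_sumD {R : realType} {X : metricType R} (T : X -> X) (u : X -> R)
    (k m : nat) (x : X) :
  birkhoff_sum T u (k + m) x =
  birkhoff_sum T u k x + birkhoff_sum T u m (iter k T x).
Proof.
rewrite /birkhoff_sum big_split_ord/=; congr (_ + _).
by apply: eq_bigr => i _; rewrite addnC iterD.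
Qed.

Lemma birkhoff_sumS {R : realType} {X : metricType R} (T : X -> X) (u : X -> R)
    (n : nat) (x : X) :
  birkhoff_sum T u n.+1 x = birkhoff_sum T u n x + u (iter n T x).
Proof. by rewrite /birkhoff_sum big_ord_recr. Qed.

(** The quantitative form in which conformality is used: at scales below [h], [T]
    is locally injective and multiplies distances by 2^u up to 2^eta.  The
    condition [T p != T q] has to be carried along, because [log2 0] is a
    meaningless value and telescoping would stop there. *)
Definition expands_near {R : realType} {X : metricType R} (T : X -> X)
    (u : X -> R) (h eta : R) : Prop :=
  forall p q, mdist p q < h ->
    `|u q - u p| <= eta /\
    (p != q -> T p != T q /\
      `|log2 (mdist (T p) (T q)) - log2 (mdist p q) - u p| <= eta).

(** The distortion at [(p, q)] is compared with its diagonal value [u p]; the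
    variation of [u] itself is the diagonal case [(q, q)] against [(p, p)]. *)
Lemma conformal_expands_near {R : realType} {X : completeMetricType R}
    (T : X -> X) (a : X -> R) : conformal_system T a ->
  forall eta : R, 0 < eta -> exists2 h : R, 0 < h &
    expands_near T (fun y => log2 (a y)) h eta.
Proof.
move=> [_ _ _ [r0 r0_gt0 [inj uc]]] eta eta0.
have [h h0 H] := uc _ eta0.
exists (Num.min r0 h); first by rewrite lt_min r0_gt0.
move=> p q; rewrite lt_min => /andP[pqr pqh].
have diag z : distortion T a z z = log2 (a z) by rewrite /distortion eqxx.
have self (z : X) (s : R) : 0 < s -> mdist z z < s by rewrite mdistxx.
have qph : mdist q p < h by rewrite metric_sym.
split.
  by rewrite -!diag; apply/ltW/H; rewrite ?self.
move=> pq; split; first exact: inj.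
have := H p q p p pqr (self p _ r0_gt0) (self p _ h0) qph.
by rewrite diag /distortion (negbTE pq) => /ltW.
Qed.

(** The logarithm of the distance telescopes along the orbits: each step adds the
    distortion, which differs from [u] on the orbit of [x] by at most [eta]. *)
Lemma log2_mdist_iter {R : realType} {X : metricType R} (T : X -> X)
    (u : X -> R) (h eta : R) (x y : X) (k : nat) :
  expands_near T u h eta -> bowen_ball T k x h y -> x != y ->
  iter k T x != iter k T y /\
  `|log2 (mdist (iter k T x) (iter k T y)) -
     (log2 (mdist x y) + birkhoff_sum T u k x)| <= k%:R * eta.
Proof.
move=> ex By xy; elim: k By => [|k IHk] By.
  by split=> //=; rewrite /birkhoff_sum big_ord0 addr0 subrr normr0 mul0r.
have [|nek IH] := IHk; first by move=> i ik; apply: By; exact: ltnW.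
have [_ /(_ nek)[neS dS]] := ex _ _ (By k (ltnSn k)).
split=> //=; rewrite birkhoff_sumS -natr1.
move: IH dS; rewrite !ler_norml => /andP[? ?] /andP[? ?].
by apply/andP; split; lra.
Qed.

Lemma birkhoff_sum_bowen {R : realType} {X : metricType R} (T : X -> X)
    (u : X -> R) (h eta : R) (x y : X) (n : nat) :
  expands_near T u h eta -> bowen_ball T n x h y ->
  `|birkhoff_sum T u n y - birkhoff_sum T u n x| <= n%:R * eta.
Proof.
move=> ex By; rewrite /birkhoff_sum -sumrB.
apply: le_trans (ler_norm_sum _ _ _) _.
rewrite -[n in n%:R]card_ord mulr_natl -sumr_const; apply: ler_sum => i _.
by have [] := ex _ _ (By i (ltn_ord i)).
Qed.

(** Since the distance is controlled only up to time [n] in the Bowen ball of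
    order [n.+1], the sum stops at [n]: one term is lost. *)
Lemma bowen_ball_sub_ball {R : realType} {X : metricType R} (T : X -> X)
    (u : X -> R) (h eta eps d : R) (x y : X) (n : nat) :
  expands_near T u h eta -> eps <= h -> 0 < eps -> 0 < d ->
  log2 eps + n%:R * eta - birkhoff_sum T u n x <= log2 d ->
  bowen_ball T n.+1 x eps y -> mdist y x < d.
Proof.
move=> ex eh e0 d0 le_d By; rewrite metric_sym.
have [->|xy] := eqVneq x y; first by rewrite mdistxx.
have Byn : bowen_ball T n x h y.
  by move=> i ? ; apply: lt_le_trans eh; apply: By; exact: ltnW.
have [nen] := log2_mdist_iter ex Byn xy.
have : log2 (mdist (iter n T x) (iter n T y)) < log2 eps.
  by rewrite ltr_log2 ?mdist_gt0//; exact: By.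
rewrite -[mdist x y < d]ltr_log2 ?mdist_gt0//.
by rewrite ler_norml => ? /andP[? ?]; lra.
Qed.

(** Induction on time: the points being close before [k], telescoping applies up
    to [k] and bounds the distance at time [k] by [eps]. *)
Lemma ball_sub_bowen_ball {R : realType} {X : metricType R} (T : X -> X)
    (u : X -> R) (h eta eps d : R) (x y : X) (n : nat) :
  expands_near T u h eta -> eps <= h -> 0 < eps -> 0 < d ->
  (forall k, (k < n)%N ->
    log2 d + birkhoff_sum T u k x + k%:R * eta <= log2 eps) ->
  mdist y x < d -> bowen_ball T n x eps y.
Proof.
move=> ex eh e0 d0 le_e; rewrite metric_sym => dxy.
have [->|xy] := eqVneq x y; first by move=> i _; rewrite mdistxx.
elim/ltn_ind => k IHk kn.
have Byk : bowen_ball T k x h y.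
  by move=> i ik; apply: lt_le_trans eh; apply: IHk => //; exact: ltn_trans kn.
have [nek] := log2_mdist_iter ex Byk xy.
have : log2 (mdist x y) < log2 d by rewrite ltr_log2 ?mdist_gt0.
rewrite -[_ < eps]ltr_log2 ?mdist_gt0//.
by have := le_e k kn; rewrite ler_norml => ? ? /andP[? ?]; lra.
Qed.

(** * The hypotheses on the orbit as bounds on Birkhoff sums *)
Lemma calA_growth {R : realType} {X : metricType R} (T : X -> X) (u : X -> R)
    (x : X) : calA T u 0%E +oo%E x ->
  exists2 c : R, 0 < c & \forall n \near \oo, c * n%:R <= birkhoff_sum T u n x.
Proof.
move=> /and3P[+ _ _]; rewrite /lower_average /limn_einf /limn_esup.
rewrite -/(limf_einf _ _) limf_einfE => /ereal_sup_gt[_ [V FV <-] Vgt0].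
have [c c0 cV] : exists2 c : R, 0 < c & (c%:E <= ereal_inf
    [set (birkhoff_sum T u n x / n%:R)%:E | n in V])%E.
  move: Vgt0; case: ereal_inf => [r| |] //; first by rewrite lte_fin; exists r.
  by exists 1; rewrite ?leey.
exists c => //; near=> n.
have n0 : 0 < n%:R :> R by rewrite ltr0n; near: n; exact: nbhs_infty_gt.
rewrite -ler_pdivlMr// -lee_fin; apply: le_trans cV _.
by apply: ereal_inf_lbound; exists n => //; near: n; exact: FV.
Unshelve. all: by end_near. Qed.

(** By the cocycle identity, [calB] says that no earlier Birkhoff sum exceeds the
    one at time [n] by more than a constant and an arbitrarily small multiple of
    [n]. *)
Lemma calB_lower_bound {R : realType} {X : metricType R} (T : X -> X)
    (u : X -> R) (x : X) : calB T u x ->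
  forall eta : R, 0 < eta -> exists M : R, forall n k, (k <= n)%N ->
    M + birkhoff_sum T u k x <= birkhoff_sum T u n x + n%:R * eta.
Proof.
move=> hB eta eta0; have := hB eta eta0.
set E := [set _ | _] => Egt.
have [M ME] : exists M : R, (M%:E <= ereal_inf E)%E.
  by move: Egt; case: ereal_inf => [r| |] // _; [exists r|exists 0; rewrite leey].
exists M => n k kn; rewrite -[in birkhoff_sum T u n x](subnKC kn) birkhoff_sumD.
have : (M%:E <= (birkhoff_sum T u (n - k) (iter k T x) + n%:R * eta)%:E)%E.
  by apply: le_trans ME _; apply: ereal_inf_lbound; exists n, k.
by rewrite lee_fin => ?; lra.
Qed.

Lemma calC_bound {R : realType} {X : metricType R} (T : X -> X)
    (u : X -> R) (x : X) : calC T u x ->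
  forall eta : R, 0 < eta ->
  \forall n \near \oo, `|u (iter n T x)| <= n%:R * eta.
Proof.
move=> hC eta eta0; near=> n.
have n0 : 0 < n%:R :> R by rewrite ltr0n; near: n; exact: nbhs_infty_gt.
rewrite mulrC -ler_pdivrMr// -[X in _ / X]gtr0_norm// -normf_div.
by near: n; exact: cvgr0_norm_le hC _ eta0.
Unshelve. all: by end_near. Qed.

Lemma near_infty_pred (P : set nat) :
  (\forall n \near \oo, P n) -> \forall n \near \oo, P n.-1.
Proof. by move=> [N _ HN]; exists N.+1 => // -[//|n] /=; exact: HN. Qed.

Lemma birkhoff_sum_cvgy {R : realType} {X : metricType R} (T : X -> X)
    (u : X -> R) (x : X) : calA T u 0%E +oo%E x ->
  birkhoff_sum T u n x @[n --> \oo] --> +oo.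
Proof.
move=> /calA_growth[c c0 growth]; apply/cvgryPge => M; near=> n.
have : c * n%:R <= birkhoff_sum T u n x by near: n.
apply: le_trans; rewrite mulrC -ler_pdivrMr//.
by near: n; exact: nbhs_infty_ger.
Unshelve. all: by end_near. Qed.

Lemma birkhoff_sum_slow {R : realType} {X : metricType R} (T : X -> X)
    (u : X -> R) (x : X) (theta : R) : calA T u 0%E +oo%E x -> calC T u x ->
  0 < theta -> \forall n \near \oo,
    birkhoff_sum T u n.+1 x <= (1 + theta) * birkhoff_sum T u n x.
Proof.
move=> /calA_growth[c c0 growth] hC theta0.
have tc0 : 0 < theta * c by rewrite mulr_gt0.
near=> n.
have sn : c * n%:R <= birkhoff_sum T u n x by near: n.
have un : `|u (iter n T x)| <= n%:R * (theta * c).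
  by near: n; exact: calC_bound.
rewrite birkhoff_sumS mulrDl mul1r lerD2l.
apply: le_trans (ler_norm _) _; apply: le_trans un _.
by rewrite mulrCA ler_pM2l// mulrC.
Unshelve. all: by end_near. Qed.

(** * Comparison of Bowen balls with metric balls *)

(** Each of the three sources of error (distortion, the lost last term, the
    excess of an earlier Birkhoff sum) costs at most [n * eta], while the margin
    [theta * s] is at least [4 * n * eta]; what remains absorbs the constants. *)
Lemma bowen_ball_sandwich {R : realType} {X : metricType R} (T : X -> X)
    (u : X -> R) (x : X) (theta : R) :
  (forall eta : R, 0 < eta -> exists2 h : R, 0 < h & expands_near T u h eta) ->
  calA T u 0%E +oo%E x -> calB T u x -> calC T u x -> 0 < theta ->
  \forall eps \near 0^'+, \forall n \near \oo,
  let s := birkhoff_sum T u n x in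
  [/\ forall d, 0 < d -> - log2 d <= (1 - theta) * s ->
        forall y, bowen_ball T n x eps y -> mdist y x < d,
      forall d, 0 < d -> (1 + theta) * s <= - log2 d ->
        forall y, mdist y x < d -> bowen_ball T n x eps y &
      forall y, bowen_ball T n x eps y ->
        (1 - theta) * s <= birkhoff_sum T u n y <= (1 + theta) * s].
Proof.
move=> exT /calA_growth[c c0 growth] hB hC theta0.
pose eta := theta * c / 4.
have eta0 : 0 < eta by rewrite divr_gt0// mulr_gt0.
have [h h0 ex] := exT _ eta0; have [M hM] := calB_lower_bound hB eta0.
have uC := near_infty_pred (calC_bound hC eta0).
near=> eps.
have e0 : 0 < eps by near: eps; exact: nbhs_right_gt.
have eh : eps <= h by near: eps; exact: nbhs_right_le.
have e1 : log2 eps < 0.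
  rewrite /log2 pmulr_llt0 ?invr_gt0 ?ln2_gt0// ln_lt0// e0/=.
  by near: eps; exact: nbhs_right_lt.
near=> n; set s := birkhoff_sum T u n x.
have sn : 4 * (n%:R * eta) <= theta * s.
  have : c * n%:R <= s by rewrite /s; near: n.
  rewrite -(ler_pM2l theta0); apply: le_trans.
  by rewrite /eta le_eqVlt; apply/orP; left; apply/eqP; field.
have ne0 : 0 <= n%:R * eta by rewrite mulr_ge0// ltW.
split.
- move=> d d0 hd y.
  have : (0 < n)%N by near: n; exact: nbhs_infty_gt.
  have : `|u (iter n.-1 T x)| <= n.-1%:R * eta.
    by near: n.
  rewrite {}/s in sn hd *; case: (n) sn ne0 hd => // m sn ne0 hd un _ By.
  apply: (bowen_ball_sub_ball ex eh e0 d0 _ By).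
  move: sn hd un; rewrite birkhoff_sumS -natr1 ler_norml => sn hd /andP[? ?].
  lra.
- move=> d d0 hd y dy; apply: (ball_sub_bowen_ball ex eh e0 d0 _ dy) => k kn.
  have nM : - M - log2 eps <= n%:R * eta.
    by rewrite -ler_pdivrMr//; near: n; exact: nbhs_infty_ger.
  have := hM n k (ltnW kn); rewrite -/s => hk.
  have kn' : k%:R * eta <= n%:R * eta by rewrite ler_pM2r// ler_nat ltnW.
  lra.
- move=> y By.
  have Byh : bowen_ball T n x h y.
    by move=> i ni; apply: lt_le_trans eh; exact: By.
  have := birkhoff_sum_bowen ex Byh; rewrite -/s ler_norml => /andP[? ?].
  by apply/andP; split; lra.
Unshelve. all: by end_near. Qed.

(** * Comparison of the dimensions *)
Lemma complexity_nat_ge0 {R : realType} (U : program) (code : nat -> seq bool)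
    (A : set nat) (i : nat) : (0%E <= complexity_nat (R := R) U code A i)%E.
Proof. by apply: le_ereal_inf_tmp => _ [tau _ <-]; rewrite lee_fin ler0n. Qed.

Lemma point_complexity_le_bowen_ratio {R : realType} {X : metricType R}
    (T : X -> X) (u : X -> R) (U : program) (code : nat -> seq bool)
    (xs : nat -> X) (A : set nat) (x : X) (eps d C : R) (n : nat) :
  0 < C -> 0 < - log2 d ->
  (forall y, bowen_ball T n x eps y -> mdist y x < d) ->
  (forall y, bowen_ball T n x eps y ->
     0 < birkhoff_sum T u n y <= C * - log2 d) ->
  (point_complexity U code xs A d x / (- log2 d)%:E <=
   C%:E * bowen_ratio T u U code xs A x eps n)%E.
Proof.
move=> C0 d0 Bd BS; rewrite -lee_pdivrMl//; apply: le_ereal_inf_tmp.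
move=> _ [i /= Bi <-]; have /andP[S0 SC] := BS _ Bi.
rewrite lee_pdivrMl// lee_div_posr//.
have PK : (point_complexity U code xs A d x <= complexity_nat U code A i)%E.
  by apply: ereal_inf_lbound; exists i => //; exact: Bd.
apply: (le_trans PK); rewrite inver gt_eqF// muleCA -EFinM -muleA -EFinM.
rewrite -[leLHS]mule1; apply: lee_wpmul2l; first exact: complexity_nat_ge0.
by rewrite lee_fin mulrAC ler_pdivlMr// mul1r.
Qed.

Lemma bowen_ratio_le_point_complexity {R : realType} {X : metricType R}
    (T : X -> X) (u : X -> R) (U : program) (code : nat -> seq bool)
    (xs : nat -> X) (A : set nat) (x : X) (eps d C : R) (n : nat) :
  0 < C -> 0 < - log2 d ->
  (forall y, mdist y x < d -> bowen_ball T n x eps y) ->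
  (forall y, bowen_ball T n x eps y -> - log2 d <= C * birkhoff_sum T u n y) ->
  (bowen_ratio T u U code xs A x eps n <=
   C%:E * (point_complexity U code xs A d x / (- log2 d)%:E))%E.
Proof.
move=> C0 d0 dB BS; rewrite -lee_pdivrMl// inver gt_eqF//.
rewrite lee_pdivlMr//; apply: le_ereal_inf_tmp => _ [i /= di <-].
have Bi := dB _ di; have SC := BS _ Bi.
have S0 : 0 < birkhoff_sum T u n (xs i).
  by rewrite -(pmulr_rgt0 _ C0); exact: lt_le_trans SC.
rewrite muleAC -EFinM; set K := complexity_nat _ _ _ _.
have bK : (bowen_ratio T u U code xs A x eps n <=
           K / (birkhoff_sum T u n (xs i))%:E)%E.
  by apply: ereal_inf_lbound; exists i.
rewrite muleC -lee_pdivlMr ?mulr_gt0 ?invr_gt0//; apply: (le_trans bK).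
rewrite inver gt_eqF//; apply: lee_wpmul2l; first exact: complexity_nat_ge0.
by rewrite lee_fin lef_pV2 ?posrE ?mulr_gt0 ?invr_gt0// ler_pdivrMl.
Qed.

(** Matching at comparable scales transfers lower and upper limits.  The
    windows of ratio [1 + theta] in the two comparison hypotheses leave room for
    the jump of [s] between consecutive times, within which a given radius may
    fall. *)
Lemma limits_comparable {R : realType} (s : nat -> R) (f : R -> \bar R)
    (b : nat -> \bar R) (theta C : R) : 0 < theta < 1 -> 0 < C ->
  s n @[n --> \oo] --> +oo ->
  (\forall n \near \oo, s n.+1 <= (1 + theta) * s n) ->
  (\forall n \near \oo, forall d, 0 < d -> 
    - log2 d <= (1 - theta) * s n <= (1 + theta) * - log2 d ->
    (f d <= C%:E * b n)%E) ->
  (\forall n \near \oo, forall d, 0 < d -> 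
    (1 + theta) * s n <= - log2 d <= (1 + theta) ^+ 2 * s n ->
    (b n <= C%:E * f d)%E) ->
  [/\ (limf_einf f 0^'+ <= C%:E * limn_einf b)%E,
      (limn_einf b <= C%:E * limf_einf f 0^'+)%E,
      (limf_esup f 0^'+ <= C%:E * limn_esup b)%E &
      (limn_esup b <= C%:E * limf_esup f 0^'+)%E].
Proof.
move=> /andP[theta0 theta1] C0 soo slow fb bf.
have m0 : 0 < 1 - theta by rewrite subr_gt0.
have p0 : 0 < 1 + theta by rewrite addr_gt0.
have s0 : \forall n \near \oo, 0 <= s n by have /cvgryPge/(_ 0) := soo.
have shrink (V : set R) : (\forall d \near 0^'+, V d) ->
    \forall n \near \oo, exists2 d, V d & (f d <= C%:E * b n)%E.
  move=> /(eventually_radius soo m0).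
  apply: filterS3 s0 fb => n sn fbn [d Vd [d0 dE]]; exists d => //.
  by apply: fbn => //; rewrite dE lexx/= ler_peMl ?lerDl ?mulr_ge0// ltW.
have grow (V : set R) : (\forall d \near 0^'+, V d) ->
    \forall n \near \oo, exists2 d, V d & (b n <= C%:E * f d)%E.
  move=> /(eventually_radius soo p0).
  apply: filterS3 s0 bf => n sn bfn [d Vd [d0 dE]]; exists d => //.
  apply: bfn => //.
  by rewrite dE lexx/= expr2 -mulrA ler_peMl ?lerDl ?mulr_ge0// ltW.
have above (V : set nat) : (\forall n \near \oo, V n) ->
    \forall d \near 0^'+, exists2 n, V n & (f d <= C%:E * b n)%E.
  move=> nV.
  pose proof (filterI nV (filterI slow fb)) as nVfb.
  have cross := eventually_crossing soo m0 nVfb.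
  apply: filterS2 (nbhs_right_gt 0) cross => d d0 [n].
  move=> [[_ [slown _]] [Vn [_ fbn]] /andP[sd ds]].
  (* [f d] needs a time past the crossing of - log2 d, the Bowen ball there being
     contained in the ball of radius [d]; the other bound needs a time before
     it. *)
  exists n.+1 => //; apply: fbn => //; rewrite (ltW ds)/=.
  apply: (@le_trans _ _ ((1 - theta) * ((1 + theta) * s n))).
    by rewrite ler_pM2l.
  by rewrite mulrCA ler_pM2l.
have below (V : set nat) : (\forall n \near \oo, V n) ->
    \forall d \near 0^'+, exists2 n, V n & (b n <= C%:E * f d)%E.
  move=> nV.
  pose proof (filterI nV (filterI slow bf)) as nVbf.
  have cross := eventually_crossing soo p0 nVbf.
  apply: filterS2 (nbhs_right_gt 0) cross => d d0 [n].
  move=> [[Vn [slown bfn]] _ /andP[sd ds]].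
  exists n => //; apply: bfn => //; rewrite sd/=; apply: le_trans (ltW ds) _.
  by rewrite expr2 -mulrA ler_pM2l.
split.
- exact: limf_einf_le_pmul.
- exact: limf_einf_le_pmul.
- exact: limf_esup_le_pmul.
- exact: limf_esup_le_pmul.
Qed.

Lemma eff_dims_comparable {R : realType} {X : metricType R} (T : X -> X)
    (u : X -> R) (U : program) (code : nat -> seq bool) (xs : nat -> X)
    (A : set nat) (x : X) (C : R) :
  (forall eta : R, 0 < eta -> exists2 h : R, 0 < h & expands_near T u h eta) ->
  calA T u 0%E +oo%E x -> calB T u x -> calC T u x -> 1 < C ->
  let b := bowen_ratio T u U code xs A x in
  \forall eps \near 0^'+,
  [/\ (eff_dim U code xs A x <= C%:E * limn_einf (b eps))%E,
      (limn_einf (b eps) <= C%:E * eff_dim U code xs A x)%E,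
      (eff_Dim U code xs A x <= C%:E * limn_esup (b eps))%E &
      (limn_esup (b eps) <= C%:E * eff_Dim U code xs A x)%E].
Proof.
move=> exT hA hB hC C1 b.
have C0 : 0 < C by rewrite (lt_trans _ C1).
(* Chosen so that 1 + 3 theta = C (1 - theta), and theta ^ 2 <= theta. *)
pose theta := (C - 1) / (C + 3).
have C3 : 0 < C + 3 by rewrite addr_gt0.
have theta0 : 0 < theta by rewrite divr_gt0// subr_gt0.
have theta1 : theta < 1 by rewrite ltr_pdivrMr// mul1r; lra.
have thetaC : (1 + theta) ^+ 2 <= C * (1 - theta).
  have thetaE : theta * (C + 3) = C - 1 by rewrite divfK// gt_eqF.
  have : theta ^+ 2 <= theta.
    by rewrite expr2 -[leRHS]mulr1 ler_pM2l// ltW.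
  by rewrite sqrrD; lra.
have := bowen_ball_sandwich exT hA hB hC theta0.
apply: filterS => eps sandwich.
have soo := birkhoff_sum_cvgy hA.
have s0 : \forall n \near \oo, 0 < birkhoff_sum T u n x.
  by have /cvgryPgt/(_ 0) := soo.
have theta01 : 0 < theta < 1 by rewrite theta0.
apply: (limits_comparable theta01 C0 soo).
- exact: birkhoff_sum_slow.
- apply: filterS2 sandwich s0 => n [Bd _ BS] sn d d0 /andP[ds sd].
  have ld0 : 0 < - log2 d.
    have : 0 < (1 + theta) * - log2 d.
      by apply: lt_le_trans sd; rewrite mulr_gt0// subr_gt0.
    by rewrite pmulr_rgt0// addr_gt0.
  apply: point_complexity_le_bowen_ratio => //; first exact: Bd.
  move=> y By; have /andP[lo hi] := BS y By; apply/andP; split.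
    by apply: lt_le_trans lo; rewrite mulr_gt0// subr_gt0.
  apply: (le_trans hi).
  have m0 : 0 < 1 - theta by rewrite subr_gt0.
  rewrite -(ler_pM2l m0) mulrCA.
  apply: (@le_trans _ _ ((1 + theta) * ((1 + theta) * - log2 d))).
    by rewrite ler_pM2l// addr_gt0.
  by rewrite mulrA -expr2 mulrA [_ * C]mulrC ler_pM2r.
- apply: filterS2 sandwich s0 => n [_ dB BS] sn d d0 /andP[sd ds].
  have ld0 : 0 < - log2 d.
    by apply: lt_le_trans sd; rewrite mulr_gt0// addr_gt0.
  apply: bowen_ratio_le_point_complexity => //; first exact: dB.
  move=> y By; have /andP[lo _] := BS y By.
  apply: (le_trans ds); apply: (@le_trans _ _
    (C * ((1 - theta) * birkhoff_sum T u n x))); last by rewrite ler_pM2l.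
  by rewrite mulrA ler_pM2r.
Qed.

Theorem theorem4p19 (R : realType) (X : completeMetricType R)
  (T : X -> X) (a : X -> R)
  (U : program) (code : nat -> seq bool) (xs : nat -> X) (x : X) :
  universal_prefix_free U ->
  computable_coding code ->
  conformal_system T a ->
  dense (range xs) ->
  let u := fun y => log2 (a y) in
  (calA T u 0%E +oo%E `&` calB T u `&` calC T u) x ->
  forall A : set nat,
    eff_dim U code xs A x = BS_dim T u U code xs A x /\
    eff_Dim U code xs A x = BS_Dim T u U code xs A x.
Proof.
move=> _ _ /conformal_expands_near exT _ u [[hA hB] hC] A.
have cmp C := eff_dims_comparable U code xs A exT hA hB hC (C := C).
have cvg_inf := @is_cvg_BS_dim R X T u U code xs A x.
have cvg_sup := @is_cvg_BS_Dim R X T u U code xs A x.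
have cvgM (C : R) (g : R -> \bar R) : 
    cvg (g eps @[eps --> 0^'+]) -> 
    (C%:E * g eps)%E @[eps --> 0^'+] --> (C%:E * lim (g eps @[eps --> 0^'+]))%E.
  by move=> ?; exact: cvgeZl.
split; apply/eqP; rewrite eq_le; apply/andP; split;
  apply: le_mul_gt1_ereal => C C1; have {}cmp := cmp C C1.
- apply: (cvge_to_ge (cvgM C _ cvg_inf)).
  by apply: filterS cmp => eps [].
- apply: (cvge_to_le cvg_inf).
  by apply: filterS cmp => eps [].
- apply: (cvge_to_ge (cvgM C _ cvg_sup)).
  by apply: filterS cmp => eps [].
- apply: (cvge_to_le cvg_sup).
  by apply: filterS cmp => eps [].
Qed.
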